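(* Let $V$ be a finite set of size $n$, let $k\in\{0,\ldots,n\}$, and let $I,J\subseteq V$ be disjoint sets of size $i=\#I$ and $j=\#J$. Then \[ \deg p^{(V,k)}_{I,J}=\begin{cases} i+j-1 & \text{if } i+j \text{ is odd and } i+j\le \min(k,n-k),\\ k-1 & \text{if } k \text{ is odd and } n=2k \text{ and } i+j\ge k,\\ \min(i+j,k,n-k) & \text{otherwise.}\end{cases} \]
   Context: $\binom{V}{k}$ is the set of all $k$-element subsets of $V$; $A^\complement=V\setminus A$ for $A\subseteq V$. For $A\subseteq B\subseteq V$, the basic function $f^{(V,k)}_{A,B}:\binom{V}{k}\to\mathbb{R}$ is the characteristic function of $\{K\in\binom{V}{k}\mid A\subseteq K\subseteq B\}$. For disjoint $I,J\subseteq V$, the paired function is $p^{(V,k)}_{I,J}=f^{(V,k)}_{I,J^\complement}+f^{(V,k)}_{J,I^\complement}$. For $T\subseteq V$ with $\#T=t$, the function $f^{(V,k)}_{T,V}$ is called a $t$-pencil. The degree $\deg(f)$ of a non-zero function $f:\binom{V}{k}\to\mathbb{R}$ is the smallest number $t$ such that $f$ is an $\mathbb{R}$-linear combination of $t$-pencils (equivalently, the minimum degree of a real polynomial in variables $X_a$, $a\in V$, whose evaluation at the $0/1$ characteristic vector of each $K\in\binom{V}{k}$ equals $f(K)$). The degree of the zero function is set to $-\infty$.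
   Formalization: The formal theorem assumes p_{I,J} is not the zero function; when it is zero (e.g. n=3, k=1, I=V, J=∅) its degree is −∞ by convention while the stated formula gives a natural number, so the claim fails exactly there. *)

(* Defs.v *)
From HB Require Import structures.
From mathcomp Require Import all_boot all_order all_algebra.
From mathcomp Require Import reals constructive_ereal.

Set Implicit Arguments.
Unset Strict Implicit.
Unset Printing Implicit Defensive.

Import GRing.Theory.
Local Open Scope ring_scope.

Definition ksubset (V : finType) (k : nat) := {K : {set V} | #|K| == k}.

(* [R^o], rather than [R], makes this a [vectType R]. *)
Definition slice_fun (R : realType) (V : finType) (k : nat) :=
  {ffun ksubset V k -> R^o}.

Definition basic (R : realType) (V : finType) (k : nat) (A B : {set V}) :
    slice_fun R V k :=
  [ffun K : ksubset V k => ((A \subset val K) && (val K \subset B))%:R].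

Definition paired (R : realType) (V : finType) (k : nat) (I J : {set V}) :
    slice_fun R V k :=
  basic R k I (~: J) + basic R k J (~: I).

Definition pencil (R : realType) (V : finType) (k : nat) (T : {set V}) :
    slice_fun R V k :=
  basic R k T [set: V].

Definition pencil_span (R : realType) (V : finType) (k t : nat) :
    {vspace slice_fun R V k} :=
  <<[seq pencil R k T | T : {set V} in [set T : {set V} | #|T| == t]]>>%VS.

(* The [k]-pencils are the indicators of single points. *)
Lemma ex_pencil_span (R : realType) (V : finType) (k : nat)
    (f : slice_fun R V k) :
  exists t, f \in pencil_span R V k t.
Proof.
exists k; have -> : f = \sum_K f K *: pencil R k (val K).
  apply/ffunP => L; rewrite sum_ffunE (bigD1 L) //= big1 => [|K neqKL].
    by rewrite !ffunE subxx subsetT addr0 [LHS](esym (mulr1 _)).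
  rewrite !ffunE subsetT andbT; case: (boolP (_ \subset _)) => [sKL|_].
    case/eqP: neqKL; apply/val_inj/eqP.
    by rewrite eqEcard sKL (eqP (valP K)) (eqP (valP L)) leqnn.
  by rewrite scaler0.
apply: memv_suml => K _; apply/memvZ/memv_span/imageP.
by exists (val K); rewrite // inE (valP K).
Qed.

Definition deg (R : realType) (V : finType) (k : nat) (f : slice_fun R V k) :
    \bar nat :=
  if f == 0 then -oo%E else (ex_minn (ex_pencil_span f))%:E.

(* Main.v *)
(* Upper bounds: modulo pencils of smaller size, [basic A (~: D)] is
   [(-1)^#|D|] times the pencil on [A :|: D]; hence the leading terms of
   [paired I J] cancel when [#|I| + #|J|] is odd.  Points are pencils of size
   [k], and also functions [basic set0 K] of degree at most [n - k].  If
   [n = 2k], then [paired I J] is the sum of the functions [paired K set0] over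
   [I <= K <= ~: J], which have degree at most [k - 1] when [k] is odd.

   Lower bounds: fix [K] with [I <= K <= ~: J] and [t] disjoint pairs
   [(a_l, b_l)] in [K * ~: K].  The alternating sum of [f] over the [2^t]
   points obtained from [K] by exchanging [a_l] with [b_l] for [l] in [S] kills
   all pencils of size less than [t].  If every pair has [a_l] in [I] or [b_l]
   in [J], only [S = set0] contributes to the first term of [paired I J] and
   only [S = setT] to the second, so the sum is [1 + (-1)^t] or [1]; the latter
   whenever some element of [I :|: J] lies in no pair. *)
From HB Require Import structures.
Require Import Defs.
From mathcomp Require Import all_boot all_order all_algebra.
From mathcomp Require Import reals constructive_ereal zify.

Set Implicit Arguments.
Unset Strict Implicit.
Unset Printing Implicit Defensive.

Import Order.TTheory GRing.Theory Num.Theory.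
Local Open Scope ring_scope.

(** * Pencils and basic functions in pencil spans *)

Lemma pencil_span_pencil (R : realType) (V : finType) (k : nat) (T : {set V}) :
  pencil R k T \in pencil_span R V k #|T|.
Proof. by apply/memv_span/imageP; exists T; rewrite ?inE. Qed.

Lemma pencil_setU1_sum (R : realType) (V : finType) (k : nat) (T : {set V}) :
  \sum_(x in ~: T) pencil R k (x |: T) = (k - #|T|)%:R *: pencil R k T.
Proof.
apply/ffunP => K; rewrite sum_ffunE !ffunE subsetT andbT.
under eq_bigr => x _ do rewrite ffunE subsetT andbT subUset sub1set.
case: (boolP (T \subset val K)) => [sTK|_]; last first.
  by rewrite big1 ?scaler0 // => x _; rewrite andbF.
rewrite [RHS]mulr1 -natr_sum; congr _%:R.
have -> : (k - #|T| = #|val K :\: T|)%N by rewrite cardsDS // (eqP (valP K)).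
rewrite -sum1_card [RHS](eq_bigl (fun x => (x \in ~: T) && (x \in val K))).
  by rewrite big_mkcondr /=; apply: eq_bigr => x _; rewrite andbT; case: ifP.
by move=> x; rewrite !inE.
Qed.

(** Averaging over one-point extensions raises the size by one; the factor [k - #|T|] is invertible
    as long as [#|T| < t <= k]. *)
Lemma pencil_mem_span (R : realType) (V : finType) (k t : nat) (T : {set V}) :
  (#|T| <= t)%N -> (t <= k)%N -> pencil R k T \in pencil_span R V k t.
Proof.
move=> /subnKC; move: (t - #|T|)%N => m; elim: m T => [|m IHm] T cT le_tk.
  by rewrite -cT addn0 pencil_span_pencil.
have nz : ((k - #|T|)%:R : R) != 0 by rewrite pnatr_eq0; lia.
rewrite -[pencil R k T]scale1r -(mulVf nz) -scalerA -pencil_setU1_sum.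
apply: memvZ; apply: memv_suml => x; rewrite inE => xT.
by apply: IHm; rewrite // cardsU1 xT; lia.
Qed.

Lemma basic_setU1 (R : realType) (V : finType) (k : nat) (A D : {set V}) x :
  basic R k A (~: (x |: D)) = basic R k A (~: D) - basic R k (x |: A) (~: D).
Proof.
apply/ffunP => K; rewrite !ffunE setCU subsetI subUset.
rewrite [_ \subset ~: [set x]]subsetC !sub1set inE.
by case: (x \in _); case: (A \subset _); case: (_ \subset _);
   rewrite /= ?subrr ?subr0.
Qed.

(** Induction on [#|D|], splitting off [x] from [D]. The total size may be [t.+1], so the leading
    pencil itself may escape the span; the term that forgets [x] has size at most [t] and is
    absorbed. *)
Lemma basic_sub_pencil (R : realType) (V : finType) (k t : nat)
    (A D : {set V}) :
  (#|A| + #|D| <= t.+1)%N -> (t <= k)%N ->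
  basic R k A (~: D) - (-1) ^+ #|D| *: pencil R k (A :|: D)
    \in pencil_span R V k t.
Proof.
have [m] := ubnP #|D|; elim: m A D => // m IHm A D ltDm le_ADt le_tk.
have [->|[x xD]] := set_0Vmem D.
  by rewrite setC0 setU0 cards0 expr0 scale1r subrr mem0v.
have cD := cardsD1 x D; rewrite xD in cD.
have := setD1K xD; set D' := D :\ x in cD * => <-.
have xD' : x \notin D' by rewrite !inE eqxx.
rewrite basic_setU1 cardsU1 xD' exprS mulN1r scaleNr opprK.
have cU := cardsU A D'; have cxA := cardsU1 x A.
rewrite -addrA [- _ + _]addrC -[_ *: _ - _]opprB setUCA setUA.
apply: memvB; last by apply: IHm; case: (x \notin A) cxA; lia.
rewrite -(subrK ((-1) ^+ #|D'| *: pencil R k (A :|: D')) (basic _ _ _ _)).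
apply: memvD; first by apply: IHm; lia.
by apply/memvZ/pencil_mem_span => //; lia.
Qed.

Lemma basic_mem_span (R : realType) (V : finType) (k t : nat) (A D : {set V}) :
  (#|A| + #|D| <= t)%N -> (t <= k)%N ->
  basic R k A (~: D) \in pencil_span R V k t.
Proof.
move=> leADt le_tk.
rewrite -(subrK ((-1) ^+ #|D| *: pencil R k (A :|: D)) (basic _ _ _ _)).
apply: memvD; first by apply: basic_sub_pencil => //; lia.
by apply/memvZ/pencil_mem_span => //; rewrite cardsU; lia.
Qed.

Lemma ksubset_subE (V : finType) (k : nat) (K L : ksubset V k) :
  (val K \subset val L) = (K == L).
Proof.
by rewrite -val_eqE eqEcard (eqP (valP K)) (eqP (valP L)) leqnn andbT.
Qed.

(** The hypothesis makes each [basic R k (A K) (B K)] the indicator of the point [K]. *)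
Lemma slice_fun_sum_basic (R : realType) (V : finType) (k : nat)
    (A B : ksubset V k -> {set V}) (f : slice_fun R V k) :
    (forall K L : ksubset V k,
      (A K \subset val L) && (val L \subset B K) = (K == L)) ->
  f = \sum_K f K *: basic R k (A K) (B K).
Proof.
move=> AB; apply/ffunP => L; rewrite sum_ffunE (bigD1 L) //= big1 => [|K neqKL].
  by rewrite !ffunE AB eqxx addr0 [LHS](esym (mulr1 _)).
by rewrite !ffunE AB (negPf neqKL) scaler0.
Qed.

Lemma span_min_full (R : realType) (V : finType) (k : nat)
    (f : slice_fun R V k) :
  (k <= #|V|)%N -> f \in pencil_span R V k (minn k (#|V| - k)).
Proof.
move=> le_kV; case: leqP => [_|lt_Vk].
  rewrite [f](@slice_fun_sum_basic _ _ _ val (fun=> [set: V])) => [|K L].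
    apply: memv_suml => K _; apply: memvZ.
    by apply: pencil_mem_span; rewrite // (eqP (valP K)).
  by rewrite subsetT andbT ksubset_subE.
(* Here [#|V| - k < k], so [K] is isolated by excluding the elements outside it. *)
rewrite [f](@slice_fun_sum_basic _ _ _ (fun=> set0) val) => [|K L].
  apply: memv_suml => K _; apply: memvZ; rewrite -[val K]setCK.
  have := cardsC (val K); rewrite (eqP (valP K)) => cKC.
  by apply: basic_mem_span; rewrite ?cards0; lia.
by rewrite sub0set ksubset_subE eq_sym.
Qed.

(** * Upper bounds for paired functions *)

Lemma pairedC (R : realType) (V : finType) (k : nat) (I J : {set V}) :
  paired R k I J = paired R k J I.
Proof. exact: addrC. Qed.

Lemma paired_mem_span (R : realType) (V : finType) (k t : nat) (I J : {set V}) :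
  (#|I| + #|J| <= t)%N -> (t <= k)%N ->
  paired R k I J \in pencil_span R V k t.
Proof. by move=> leIJ le_tk; apply: memvD; apply: basic_mem_span; lia. Qed.

(* The two leading pencils, both on [I :|: J], have opposite signs. *)
Lemma paired_mem_span_odd (R : realType) (V : finType) (k t : nat)
    (I J : {set V}) :
  (#|I| + #|J| = t.+1)%N -> ~~ odd t -> (t <= k)%N ->
  paired R k I J \in pencil_span R V k t.
Proof.
move=> cIJ ev le_tk.
have h1 := @basic_sub_pencil R V k t I J.
have h2 := @basic_sub_pencil R V k t J I.
have := memvD (h1 _ le_tk) (h2 _ le_tk).
rewrite [J :|: I]setUC addrACA -opprD -scalerDl.
have -> : ((-1) ^+ #|J| + (-1) ^+ #|I| : R) = 0.
  rewrite -signr_odd -[in X in _ + X]signr_odd.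
  have -> : odd #|I| = ~~ odd #|J| by lia.
  by case: (odd _); rewrite /= ?expr0 ?expr1 ?subrr ?addNr.
by rewrite scale0r subr0; apply; lia.
Qed.

(** As [#|V| = 2 * k], [basic R k set0 (~: val K)] is the indicator of the complement of [K], and
    complementation exchanges the two intervals defining [paired R k I J]. *)
Lemma paired_sum_middle (R : realType) (V : finType) (k : nat) (I J : {set V}) :
  #|V| = (2 * k)%N ->
  paired R k I J =
    \sum_(K : ksubset V k | (I \subset val K) && (val K \subset ~: J))
      paired R k (val K) set0.
Proof.
move=> cV; rewrite big_split /=; congr (_ + _); apply/ffunP => L;
  rewrite sum_ffunE ffunE.
  case: (boolP ((I \subset val L) && _)) => h.
    rewrite (bigD1 L) //= big1 ?addr0 => [|K /andP[_ nKL]].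
      by rewrite ffunE setC0 subsetT subxx.
    by rewrite ffunE setC0 subsetT andbT ksubset_subE (negPf nKL).
  rewrite big1 // => K hK; rewrite ffunE setC0 subsetT andbT ksubset_subE.
  by case: eqP h => // <-; rewrite hK.
have cLC : #|~: val L| == k by rewrite cardsCs setCK (eqP (valP L)) cV; lia.
pose L' : ksubset V k := exist _ (~: val L) cLC.
have E K : (basic R k set0 (~: val K) : slice_fun R V k) L = (K == L')%:R.
  by rewrite ffunE sub0set /= -ksubset_subE /= subsetC.
under eq_bigr do rewrite E.
have -> : (J \subset val L) && (val L \subset ~: I)
   = (I \subset val L') && (val L' \subset ~: J).
  by rewrite /= setCS andbC subsetC.
case: (boolP ((I \subset val L') && _)) => h.
  rewrite (bigD1 L') //= big1 ?addr0 => [|K /andP[_ /negPf ->]] //.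
  by rewrite eqxx.
by rewrite big1 // => K hK; case: eqP h => // <-; rewrite hK.
Qed.

Lemma paired_mem_span_middle (R : realType) (V : finType) (k : nat)
    (I J : {set V}) :
  #|V| = (2 * k)%N -> odd k ->
  paired R k I J \in pencil_span R V k k.-1.
Proof.
move=> cV oddk; rewrite paired_sum_middle //; apply: memv_suml => K _.
by apply: paired_mem_span_odd; rewrite ?cards0 ?(eqP (valP K)); lia.
Qed.

(** * Characterization of the degree *)

Lemma deg_eq (R : realType) (V : finType) (k t : nat) (f : slice_fun R V k) :
    f != 0 -> f \in pencil_span R V k t ->
    (forall s, (s < t)%N -> f \notin pencil_span R V k s) ->
  deg f = t%:E%E.
Proof.
move=> nzf ft lt_t; rewrite /deg (negPf nzf); congr (_%:E)%E.
case: ex_minnP => m fm min_m; apply/eqP; rewrite eqn_leq min_m //=.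
by rewrite leqNgt; apply: contraL fm => /lt_t.
Qed.

(** * Alternating sums over exchanges of pairs *)

Section SwapSum.

Variables (R : realType) (V : finType) (k t : nat) (K : {set V}).
Variables (a b : 'I_t -> V).
Hypotheses (cK : #|K| = k) (inj_a : injective a) (inj_b : injective b).
Hypotheses (aK : forall l, a l \in K) (bK : forall l, b l \notin K).

Definition swap (S : {set 'I_t}) : {set V} := (K :\: a @: S) :|: b @: S.

Lemma a_in_swap l S : (a l \in swap S) = (l \notin S).
Proof.
rewrite !inE aK andbT mem_imset //.
have /negPf-> : a l \notin b @: S; last by rewrite orbF.
by apply/imsetP => -[m _ e]; have := bK m; rewrite -e aK.
Qed.

Lemma b_in_swap l S : (b l \in swap S) = (l \in S).
Proof. by rewrite !inE (negPf (bK l)) andbF mem_imset. Qed.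

Lemma card_swap S : #|swap S| == k.
Proof.
have saK : a @: S \subset K by apply/subsetP => _ /imsetP[l _ ->].
rewrite cardsU cardsDS // !card_imset //.
have -> : (K :\: a @: S) :&: b @: S = set0.
  apply/setP => x; rewrite !inE; apply/negP => /andP[/andP[_ xK]].
  by case/imsetP => l _ exb; have := bK l; rewrite -exb xK.
have := subset_leq_card saK; rewrite card_imset // cK cards0; lia.
Qed.

Definition swap_ksubset S : ksubset V k := exist _ (swap S) (card_swap S).

Definition swap_sum (f : slice_fun R V k) : R :=
  \sum_(S : {set 'I_t}) (-1) ^+ #|S| * f (swap_ksubset S).

Lemma swap_sumD f g : swap_sum (f + g) = swap_sum f + swap_sum g.
Proof.
by rewrite -big_split; apply: eq_bigr => S _; rewrite ffunE mulrDr.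
Qed.

(* Some pair avoids [T]; swapping it flips the sign only. *)
Lemma swap_sum_pencil (T : {set V}) :
  (#|T| < t)%N -> swap_sum (pencil R k T) = 0.
Proof.
move=> ltTt.
have [l /norP[alT blT]] : exists l, ~~ ((a l \in T) || (b l \in T)).
  apply/existsP; rewrite -negb_forall; apply: contraL ltTt => /forallP hit.
  (* If every pair met [T], [c] would inject ['I_t] into [T]: values [a l] and [b m] differ, lying
     inside and outside [K]. *)
  pose c l := if a l \in T then a l else b l.
  have inj_c : injective c.
    move=> l m; rewrite /c.
    case: ifP => _; case: ifP => _ e; first exact: inj_a; last exact: inj_b.
      by have := bK m; rewrite -e aK.
    by have := bK l; rewrite e aK.
  have := card_imset [set: 'I_t] inj_c; rewrite cardsT card_ord -leqNgt => <-.
  apply/subset_leq_card/subsetP => _ /imsetP[m _ ->]; rewrite /c.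
  by have := hit m; case: ifP.
pose h (S : {set 'I_t}) := if l \in S then S :\ l else l |: S.
have hK : involutive h.
  move=> S; rewrite /h; case: (boolP (l \in S)) => lS.
    by rewrite !inE eqxx setD1K.
  by rewrite !inE eqxx setU1K.
have in_swap_h S x : x \in T -> (x \in swap (h S)) = (x \in swap S).
  move=> xT; have xal : x != a l by apply: contraNneq alT => <-.
  have xbl : x != b l by apply: contraNneq blT => <-.
  rewrite /swap /h; case: ifP => lS; last first.
    by rewrite !imsetU1 !inE (negPf xal) (negPf xbl).
  by rewrite -{3 4}(setD1K lS) !imsetU1 !inE (negPf xal) (negPf xbl).
have swapE : swap_sum (pencil R k T) = - swap_sum (pencil R k T).
  rewrite {1}/swap_sum (reindex_inj (inv_inj hK)) /= -sumrN.
  apply: eq_bigr => S _; rewrite !ffunE !subsetT !andbT -mulNr /=.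
  congr (_ * _%:R).
    rewrite /h; case: ifP => lS; last by rewrite cardsU1 lS exprS mulN1r.
    by rewrite [in RHS](cardsD1 l) lS exprS mulN1r opprK.
  congr nat_of_bool; apply/subsetP/subsetP => sT x xT.
    by rewrite -in_swap_h ?sT.
  by rewrite in_swap_h ?sT.
by apply/eqP; rewrite -eqNr -swapE.
Qed.

Lemma swap_sum_span s f :
  (s < t)%N -> f \in pencil_span R V k s -> swap_sum f = 0.
Proof.
move=> lt_st.
have swap_sum_linear : linear (swap_sum : slice_fun R V k -> R^o).
  move=> c f1 f2; rewrite -[RHS]/(c * swap_sum f1 + swap_sum f2) swap_sumD.
  congr (_ + _); rewrite /swap_sum mulr_sumr.
  by apply: eq_bigr => S _; rewrite ffunE mulrCA.
(* For a linear form, vanishing on the span need only be checked on pencils. *)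
pose phiL := GRing.isLinear.Build _ _ _ _ _ swap_sum_linear.
pose phi : {linear slice_fun R V k -> R^o} :=
    HB.pack (swap_sum : slice_fun R V k -> R^o) phiL.
suff /subvP sub : (pencil_span R V k s <= lker (linfun phi))%VS.
  by move/sub; rewrite memv_ker lfunE => /eqP.
apply/span_subvP => _ /imageP[T + ->]; rewrite inE => /eqP cT.
by rewrite memv_ker lfunE /= swap_sum_pencil ?cT.
Qed.

Variables I J : {set V}.
Hypotheses (IK : I \subset K) (KJ : K \subset ~: J).
Hypothesis hit : forall l, (a l \in I) || (b l \in J).

(** For [l] in [S], either [a l] in [I] has been removed or [b l] in [J] has been added, so only
    [set0] contributes. *)
Lemma swap_sum_basic : swap_sum (basic R k I (~: J)) = 1.
Proof.
rewrite /swap_sum (bigD1 set0) //= big1 => [|S].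
  rewrite cards0 expr0 mul1r addr0 ffunE /= /swap !imset0 setD0 setU0.
  by rewrite IK KJ.
case/set0Pn => l lS; rewrite ffunE /=.
case: (boolP (_ && _)) => [/andP[/subsetP sI /subsetP sJ]|_]; last exact: mulr0.
case/orP: (hit l) => [/sI|hJ]; first by rewrite a_in_swap lS.
have /sJ : b l \in swap S by rewrite b_in_swap.
by rewrite inE hJ.
Qed.

(** Dually, an index outside [S] keeps some [a l] in [I] or omits some [b l] in [J]. The remaining
    boolean tests whether the pairs cover [I :|: J]. *)
Lemma swap_sum_basicC :
  swap_sum (basic R k J (~: I)) =
    (-1) ^+ t * ((J \subset swap setT) && (swap setT \subset ~: I))%:R.
Proof.
rewrite /swap_sum (bigD1 setT) //= big1 => [|S].
  by rewrite cardsT card_ord addr0 ffunE.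
rewrite -subTset => /subsetPn[l _ lS]; rewrite ffunE /=.
case: (boolP (_ && _)) => [/andP[/subsetP sJ /subsetP sI]|_]; last exact: mulr0.
case/orP: (hit l) => [hI|/sJ]; last by rewrite b_in_swap (negPf lS).
have /sI : a l \in swap S by rewrite a_in_swap.
by rewrite inE hI.
Qed.

(** The alternating sum is [1 + (-1) ^+ t * e] with [e] equal to 0 or 1; it vanishes only if [t] is
    odd and [e = 1]. *)
Lemma paired_notin_span_swap s :
    odd t ==> ~~ ((J \subset swap setT) && (swap setT \subset ~: I)) ->
  (s < t)%N -> paired R k I J \notin pencil_span R V k s.
Proof.
move=> odd_unhit lt_st; apply/negP => /(swap_sum_span lt_st) /eqP.
rewrite swap_sumD swap_sum_basic swap_sum_basicC -signr_odd.
apply/negP; case: (odd t) odd_unhit => /= [/negPf->|_].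
  by rewrite mulr0 addr0 oner_eq0.
by rewrite expr0 mul1r -(natrD _ 1) pnatr_eq0.
Qed.

End SwapSum.

(** * Choice of the pairs and lower bounds *)

Lemma ex_front_loaded_enum (V : finType) (x0 : V) (X I : {set V}) :
  I \subset X ->
  exists s : seq V,
    [/\ uniq s, s =i X & forall l, (l < #|I|)%N -> nth x0 s l \in I].
Proof.
move=> sIX; exists (enum I ++ enum (X :\: I)); split.
- rewrite cat_uniq !enum_uniq andbT /=; apply/hasPn => x.
  by rewrite !mem_enum inE => /andP[].
- move=> x; rewrite mem_cat !mem_enum !inE.
  by case: (boolP (x \in I)) => // /(subsetP sIX) ->.
- by move=> l ltlI; rewrite nth_cat -cardE ltlI -mem_enum mem_nth -?cardE.
Qed.

(* Taking [X] with [I] first and [Y] with [J] last: the index [l] misses both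
   only if [#|I| <= l < t - #|J|]. *)
Lemma ex_hitting_pairs (V : finType) (t : nat) (X Y I J : {set V}) :
    I \subset X -> J \subset Y -> (t <= #|X|)%N -> (t <= #|Y|)%N ->
    (t <= #|I| + #|J|)%N ->
  exists a b : 'I_t -> V,
    [/\ injective a, injective b, forall l, a l \in X, forall l, b l \in Y
      & forall l, (a l \in I) || (b l \in J)].
Proof.
move=> sIX sJY le_tX le_tY le_tIJ.
(* [nth] needs a default element; if [X] is empty, then [t = 0] and no value is required. *)
have [X0|[x0 _]] := set_0Vmem X.
  have t0 : t = 0%N by move: le_tX; rewrite X0 cards0; lia.
  have noI : 'I_t -> False by rewrite t0 => -[].
  by exists (fun l => False_rect _ (noI l)), (fun l => False_rect _ (noI l));
    split=> l; case: (noI l).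
have [s [s_uniq sX sI]] := ex_front_loaded_enum x0 sIX.
have [u [u_uniq uY uJ]] := ex_front_loaded_enum x0 sJY.
have szs : size s = #|X| by rewrite -(card_uniqP s_uniq); apply: eq_card.
have szu : size u = #|Y| by rewrite -(card_uniqP u_uniq); apply: eq_card.
(* The index [t - l.+1] reads [u] backwards, giving [J] the last indices. *)
exists (fun l => nth x0 s l), (fun l => nth x0 u (t - l.+1)%N); split.
- move=> l m /eqP; rewrite nth_uniq // => [/eqP/val_inj //| |];
    rewrite szs; have := ltn_ord l; have := ltn_ord m; lia.
- move=> l m /eqP; have ltl := ltn_ord l; have ltm := ltn_ord m.
  rewrite nth_uniq // ?szu => [/eqP e| |]; [|lia..].
  by apply/val_inj => /=; lia.
- by move=> l; rewrite -sX mem_nth // szs; have := ltn_ord l; lia.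
- by move=> l; rewrite -uY mem_nth // szu; have := ltn_ord l; lia.
- move=> l; case: (ltnP l #|I|) => [/sI -> //|leIl].
  by rewrite uJ ?orbT //; have := ltn_ord l; lia.
Qed.

Lemma paired_notin_span (R : realType) (V : finType) (k s t : nat)
    (K I J : {set V}) :
    #|K| = k -> I \subset K -> K \subset ~: J ->
    (t <= k)%N -> (t <= #|V| - k)%N -> (t <= #|I| + #|J|)%N ->
    (odd t -> (t < #|I| + #|J|)%N /\ (2 * t < #|V|)%N) ->
  (s < t)%N -> paired R k I J \notin pencil_span R V k s.
Proof.
move=> cK sIK sKJ le_tk le_tVk le_tIJ odd_t lt_st.
have sJK : J \subset ~: K by rewrite subsetC.
have cKC := cardsC K; rewrite cK in cKC.
have cIK := subset_leq_card sIK; have cJK := subset_leq_card sJK.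
have [todd|teven] := boolP (odd t); last first.
  have [|||a [b [inj_a inj_b aK bK hit]]] :=
    @ex_hitting_pairs _ t _ _ _ _ sIK sJK; try lia.
  apply: (@paired_notin_span_swap R V k t K a b cK) => //;
    last by rewrite (negPf teven).
  by move=> l; have := bK l; rewrite inE.
have [lt_tIJ lt_tV] := odd_t todd.
(* Room for a [w] outside all pairs: if [I] or [J] is empty, the other has more than [t] elements,
   inside [~: K] or [K]; otherwise [2 * t < #|V|] suffices. *)
have [[lt_tVk J_gt0]|[lt_tk I_gt0]] :
    (t < #|V| - k)%N /\ (0 < #|J|)%N \/ (t < k)%N /\ (0 < #|I|)%N by lia.
  have [w wJ] := card_gt0P J_gt0.
  have wK : w \notin K by have := subsetP sJK w wJ; rewrite inE.
  have cJ := cardsD1 w J; have cKw := cardsD1 w (~: K).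
  rewrite wJ in cJ; rewrite inE wK in cKw.
  have [|||a [b [inj_a inj_b aK bK hit]]] :=
    @ex_hitting_pairs _ t _ _ _ _ sIK (setSD [set w] sJK); try lia.
  apply: (@paired_notin_span_swap R V k t K a b cK) => //.
  - by move=> l; have := bK l; rewrite !inE => /andP[].
  - by move=> l; have := hit l; rewrite !inE => /orP[-> //|/andP[_ ->]]; rewrite orbT.
  (* The unpaired [w] in [J] never enters the swapped set. *)
  - rewrite todd /=; apply/nandP; left; apply/subsetPn; exists w => //.
    rewrite !inE (negPf wK) andbF /=; apply/imsetP => -[l _ ewb].
    by have := bK l; rewrite -ewb !inE eqxx.
have [w wI] := card_gt0P I_gt0.
have wK := subsetP sIK w wI.
have cI := cardsD1 w I; have cKw := cardsD1 w K.
rewrite wI in cI; rewrite wK in cKw.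
have [|||a [b [inj_a inj_b aK bK hit]]] :=
  @ex_hitting_pairs _ t _ _ _ _ (setSD [set w] sIK) sJK; try lia.
apply: (@paired_notin_span_swap R V k t K a b cK) => //.
- by move=> l; have := aK l; rewrite !inE => /andP[].
- by move=> l; have := bK l; rewrite inE.
- by move=> l; have := hit l; rewrite !inE => /orP[/andP[_ ->] //|->]; rewrite orbT.
(* The unpaired [w] in [I] never leaves the swapped set. *)
- rewrite todd /=; apply/nandP; right; apply/subsetPn.
  exists w; last by rewrite inE wI.
  rewrite !inE wK andbT; apply/orP; left; apply/imsetP => -[l _ ewa].
  by have := aK l; rewrite -ewa !inE eqxx.
Qed.

(** * The degree formula *)

Lemma deg_paired (R : realType) (V : finType) (k : nat) (K : ksubset V k)
    (I J : {set V}) :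
    I \subset val K -> val K \subset ~: J -> paired R k I J != 0 ->
  deg (paired R k I J) =
    (if odd (#|I| + #|J|) && (#|I| + #|J| <= minn k (#|V| - k))
       then #|I| + #|J| - 1
     else if [&& odd k, #|V| == 2 * k & k <= #|I| + #|J|] then k - 1
     else minn (#|I| + #|J|) (minn k (#|V| - k)))%N%:E%E.
Proof.
move=> sIK sKJ nzp; have cK := eqP (valP K).
have le_kV := max_card (mem (val K)); rewrite cK in le_kV.
apply: deg_eq => //.
  case: ifP => [/andP[oddIJ le_IJ]|_]; first by apply: paired_mem_span_odd; lia.
  case: ifP => [/and3P[oddk /eqP cV _]|_].
    by rewrite subn1; apply: paired_mem_span_middle.
  have [le_IJ|_] := leqP (#|I| + #|J|) (minn k (#|V| - k)).
    by apply: paired_mem_span; lia.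
  exact: span_min_full.
move=> s; set t := (X in (s < X)%N) => lt_st.
(* The first two cases give even [t]. In the third, an odd [t] equal to [#|I| + #|J|] would fall
   under the first case, and an odd [t] with [2 * t = #|V|] under the second. *)
have [le_t [le_tIJ odd_t]] :
    (t <= minn k (#|V| - k))%N /\ (t <= #|I| + #|J|)%N /\
    (odd t -> (t < #|I| + #|J|)%N /\ (2 * t < #|V|)%N).
  by rewrite /t; case: ifP => [|c1]; [|case: ifP => [|c2]]; lia.
by apply: (paired_notin_span R cK sIK sKJ) lt_st => //; lia.
Qed.

Local Close Scope ring_scope.

Theorem theorem1 (R : realType) (n k i j : nat) (V : finType) (I J : {set V})
    (hn : #|V| = n) (hk : k <= n) (hIJ : [disjoint I & J])
    (hi : #|I| = i) (hj : #|J| = j)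
    (hp : (paired R k I J != 0)%R) :
  deg (paired R k I J) =
    (if odd (i + j) && (i + j <= minn k (n - k)) then i + j - 1
     else if [&& odd k, n == 2 * k & k <= i + j] then k - 1
     else minn (i + j) (minn k (n - k)))%N%:E.
Proof.
(* A point of the support lies in one of the two intervals; exchanging [I] and [J] reduces to the
   first. *)
have [K nzK] : exists K, (paired R k I J K != 0)%R.
  apply/existsP; apply: contraNT hp => /existsPn p0.
  by apply/eqP/ffunP => K; rewrite [RHS]ffunE; apply/eqP/negPn/p0.
rewrite -hn -hi -hj.
have [/andP[sIK sKJ]|nIJ] := boolP ((I \subset val K) && (val K \subset ~: J)).
  exact: deg_paired sIK sKJ hp.
have [/andP[sJK sKI]|nJI] := boolP ((J \subset val K) && (val K \subset ~: I)).
  rewrite pairedC addnC; apply: deg_paired sJK sKI _.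
  by rewrite pairedC.
by rewrite !ffunE (negPf nIJ) (negPf nJI) addr0 eqxx in nzK.
Qed.
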